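(* Let $N\ge1$, let $p$ be a prime with $p\nmid N$, let $r,s$ be positive integers and $f\in\mathcal{M}(N)$. Then $$f|\mathcal{T}(p^{r})\mathcal{T}(p^{s})=\prod_{d\mid (p^{r},p^{s})}\Big(f|\mathcal{T}\Big(\frac{p^{r+s}}{d^{2}}\Big)\Big)^{d}.$$
   Context: Let $q=e^{2\pi i\tau}$. $\mathcal{M}(N)$ denotes the multiplicative group of meromorphic modular forms $f$ on the upper half-plane of some integer weight $k$ for $\Gamma_0(N)$ with some unitary multiplier system (i.e. $f(\gamma\tau)=\chi(\gamma)(c\tau+d)^kf(\tau)$ for $\gamma\in\Gamma_0(N)$, $\chi:\Gamma_0(N)\to S^1$, meromorphic at cusps), with integer Fourier coefficients at $i\infty$ and leading coefficient $1$. With $(f|_k\gamma)(\tau)=\det(\gamma)^{k/2}(c\tau+d)^{-k}f(\gamma\tau)$, for a prime $p\nmid N$, $r\ge1$ and $f\in\mathcal{M}(N)$ of weight $k$: $f|\mathcal{T}(p^{r}):=\varepsilon\, p^{\frac{k}{1-p}\left(\frac{p^{r+1}-p}{p-1}-\frac{r}{2}(p^{r+1}+1)\right)}\prod_{ad=p^{r},\,0\le b<d}f|_{k}\begin{psmallmatrix}a&b\\0&d\end{psmallmatrix}$ ($a,d>0$), with $\varepsilon$ the constant making the leading coefficient 1; it lies in $\mathcal{M}(N)$ with weight $k\sigma(p^r)$. $\mathcal{T}(1)$ is the identity. $f|\mathcal{T}(a)\mathcal{T}(b)$ means $(f|\mathcal{T}(a))|\mathcal{T}(b)$, each operator using the weight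 of its argument. *)

(* Defs.v *)
From HB Require Import structures.
From mathcomp Require Import all_boot all_order all_algebra.
From mathcomp Require Import complex.
From mathcomp Require Import all_classical all_reals all_analysis.

Set Implicit Arguments.
Unset Strict Implicit.
Unset Printing Implicit Defensive.

Import Order.TTheory GRing.Theory Num.Theory.
Import numFieldNormedType.Exports.

Local Open Scope classical_set_scope.
Local Open Scope complex_scope.
Local Open Scope ring_scope.

(* R[i] seen as an abstract numFieldType: this is what gives it the topology of
   its norm, and makes derivability of a function C -> C mean complex
   differentiability. *)
Definition cplx (R : realType) : numFieldType := R[i].

Section MeromorphicFunctions.
Variable R : realType.
Local Notation C := (cplx R).
Implicit Types (f g : C -> C) (z t : C) (U : set C).

Definition cpair (x y : R) : C := x +i* y.
Definition creal (x : R) : C := cpair x 0.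
Definition re z : R := complex.Re z.
Definition im z : R := complex.Im z.

Definition uhp : set C := [set z | 0 < im z].

(* A meromorphic function on an open set U is represented by a total function
   whose values at isolated points (such as poles) are irrelevant: two total
   functions represent the same meromorphic function when they agree on a
   punctured neighbourhood of every point of U. *)
Definition mero_eq U f g := forall z, U z -> \forall w \near z^', f w = g w.

Definition holomorphic_at g z := \forall w \near z, derivable g w 1.

Definition meromorphic_on U f :=
  forall z, U z -> exists (n : nat) (g : C -> C),
    holomorphic_at g z /\ \forall w \near z^', f w = g w / (w - z) ^+ n.

Definition cexp z : C :=
  creal (expR (re z)) * cpair (cos (im z)) (sin (im z)).

(* e2pii t = exp (2 pi i t), so that q ^ h = e2pii (h t) for every real h *)
Definition e2pii t : C := cexp (cpair 0 (2 * pi) * t).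

(* f = q ^ h * \sum_n a_n q ^ (n / w) near i oo.  The real shift h accounts for
   the multiplier and for negative exponents. *)
Definition fourier_expansion (w : nat) (h : R) (a : nat -> C) f :=
  exists (Y : R) (g : C -> C),
    (forall t, Y < im t ->
       series (fun n => a n * e2pii (n%:R / w%:R * t)) @ \oo --> g t) /\
    mero_eq [set t | Y < im t] f (fun t => e2pii (creal h * t) * g t).

(* c is the coefficient of the lowest power of q in the expansion of f; it does
   not depend on the w for which f is expanded in powers of q ^ (1 / w). *)
Definition is_leading_coef f (c : C) :=
  c != 0 /\ exists (w : nat) (h : R) (a : nat -> C),
    [/\ (0 < w)%N, fourier_expansion w h a f & a 0%N = c].

End MeromorphicFunctions.

Definition mx22 (a b c d : int) : 'M[int]_2 :=
  \matrix_(i, j) if i == 0 then if j == 0 then a else b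
                 else if j == 0 then c else d.

Definition SL2Z : set 'M[int]_2 := [set A | \det A = 1].

Definition Gamma0 (N : nat) : set 'M[int]_2 :=
  [set A | \det A = 1 /\ (N%:Z %| A 1%R 0%R)%Z].

Section ModularForms.
Variable R : realType.
Local Notation C := (cplx R).

Definition autj (A : 'M[int]_2) (t : C) : C := (A 1 0)%:~R * t + (A 1 1)%:~R.

Definition moebius (A : 'M[int]_2) (t : C) : C :=
  ((A 0 0)%:~R * t + (A 0 1)%:~R) / autj A t.

Definition slash (k : int) (A : 'M[int]_2) (f : C -> C) (t : C) : C :=
  creal ((\det A)%:~R `^ (k%:~R / 2)) * autj A t ^ (- k) * f (moebius A t).

(* a function bundled with its weight, so that operators depending on the
   weight always use that of their argument *)
Record weighted := Weighted { weight : int; wfun :> C -> C }.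

(* Membership in the group M(N).  Every cusp of Gamma0(N) has width dividing N,
   so that q ^ (1 / N) is a local parameter for f|_k A for all A in SL_2(Z). *)
Definition modular_form (N : nat) (f : weighted) :=
  [/\ meromorphic_on (@uhp R) f,
      exists chi : 'M[int]_2 -> C,
        forall A, Gamma0 N A -> `|chi A| = 1 /\
          mero_eq (@uhp R) (fun t => f (moebius A t))
                           (fun t => chi A * autj A t ^ weight f * f t),
      forall A, SL2Z A -> exists (h : R) (a : nat -> C),
        fourier_expansion N h a (slash (weight f) A f) &
      exists (h : R) (a : nat -> int),
        a 0%N = 1 /\ fourier_expansion 1 h (fun n => (a n)%:~R) f].

Definition sigma (n : nat) : nat := (\sum_(d <- divisors n) d)%N.

Definition hecke_const (k : int) (p r : nat) : R :=
  p%:R `^ (k%:~R / (1 - p%:R) *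
           ((p%:R ^+ r.+1 - p%:R) / (p%:R - 1)
            - r%:R / 2 * (p%:R ^+ r.+1 + 1))).

Definition hecke_prod (k : int) (m : nat) (f : C -> C) (t : C) : C :=
  \prod_(d <- divisors m) \prod_(0 <= b < d)
    slash k (mx22 (m %/ d)%N b 0 d) f t.

(* the constant eps for which eps * g has leading coefficient 1 *)
Definition normalizing_const (g : C -> C) : C :=
  xget 0 [set eps | is_leading_coef (fun t => eps * g t) 1].

(* the operator T(m), for m = 1 or m = p ^ r a prime power *)
Definition heckeT (m : nat) (f : weighted) : weighted :=
  if m == 1%N then f else
  let p := pdiv m in
  let g t := creal (hecke_const (weight f) p (logn p m))
             * hecke_prod (weight f) m f t in
  Weighted (weight f * (sigma m)%:Z) (fun t => normalizing_const g * g t).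

End ModularForms.

(* Main.v *)
Require Import Defs.
From HB Require Import structures.
From mathcomp Require Import all_boot all_order all_algebra.
From mathcomp Require Import complex.
From mathcomp Require Import all_classical all_reals all_analysis.
From mathcomp Require Import ring lra zify.
Import Order.TTheory GRing.Theory Num.Theory.
Import numFieldNormedType.Exports.
Local Open Scope classical_set_scope.
Local Open Scope complex_scope.
Local Open Scope ring_scope.

(** Up to a nonzero constant, f|T(p ^ n) is the product of f((a t + b) / d) over
    ad = p ^ n and 0 <= b < d.  Since f(t + 1) is a constant multiple of f(t),
    only b mod d matters up to constants, and counting the products of two upper
    triangular matrices by their scalar factor p ^ j gives the relation up to a
    constant.  Both sides have leading coefficient 1: leading coefficients exist
    for all the functions involved because Fourier expansions are stable under
    t |-> (a t + b) / d and, by Cauchy products, under multiplication; they are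
    unique because c e(h t) is the asymptotic behaviour at i oo.  Hence the
    constant is 1. *)

(** * The complex exponential *)

Section ComplexExponential.
Variable R : realType.
Local Notation C := (cplx R).
Local Notation creal := (@creal R).
Implicit Types (z w t u : C) (x y : R).

Lemma crealD x y : creal (x + y) = creal x + creal y.
Proof. exact: (rmorphD (real_complex R)). Qed.

Lemma crealM x y : creal (x * y) = creal x * creal y.
Proof. exact: (rmorphM (real_complex R)). Qed.

Lemma crealX x n : creal (x ^+ n) = creal x ^+ n.
Proof. exact: (rmorphXn (real_complex R)). Qed.

Lemma creal_nat n : creal n%:R = n%:R.
Proof. exact: (rmorph_nat (real_complex R)). Qed.

Lemma crealV x : creal x^-1 = (creal x)^-1.
Proof. exact: (fmorphV (real_complex R)). Qed.

Lemma ler_creal x y : (creal x <= creal y) = (x <= y).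
Proof. exact: lecR. Qed.

Lemma ltr_creal x y : (creal x < creal y) = (x < y).
Proof. exact: ltcR. Qed.

Lemma creal_eq0 x : (creal x == 0) = (x == 0).
Proof. by rewrite -[0 : C]/(creal 0) eq_le !ler_creal -eq_le. Qed.

(** Norms on a [numFieldType] take values in the field itself. This extracts the underlying real
    number, so that estimates can be made in [R]. *)
Lemma creal_norm z : exists2 x, 0 <= x & `|z| = creal x.
Proof.
have /complex_realP[x zx] : (`|z| : R[i]) \is Num.real by exact: normr_real.
by exists x => //; rewrite -ler_creal -[creal x]/(x%:C : C) -zx; exact: normr_ge0.
Qed.

Lemma imD z w : im (z + w) = im z + im w.
Proof. by case: z; case: w. Qed.

Lemma im_crealM x z : im (creal x * z) = x * im z.
Proof. by case: z => a b; rewrite /im /= mul0r addr0. Qed.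

Lemma cexpD z w : cexp (z + w) = cexp z * cexp w.
Proof.
rewrite /cexp; case: z => a b; case: w => c d; rewrite /re /im /=.
rewrite expRD crealM cosD sinD.
rewrite mulrACA; congr (_ * _).
by congr (Complex _ _); rewrite //= addrC.
Qed.

Lemma e2pii0 : e2pii (0 : C) = 1.
Proof.
rewrite /e2pii mulr0 /cexp /re /im /= expR0 cos0 sin0.
by rewrite -[creal 1]/(1 : C) mul1r.
Qed.

Lemma e2piiD z w : e2pii (z + w) = e2pii z * e2pii w.
Proof. by rewrite /e2pii mulrDr cexpD. Qed.

Lemma e2pii_neq0 z : e2pii z != 0.
Proof.
apply/eqP => z0; have := e2piiD z (- z).
by rewrite subrr e2pii0 z0 mul0r => /eqP; rewrite oner_eq0.
Qed.

Lemma e2piiX z n : e2pii (n%:R * z) = e2pii z ^+ n.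
Proof.
elim: n => [|n IHn]; first by rewrite mul0r e2pii0.
by rewrite exprS -IHn -e2piiD -natr1 mulrDl mul1r addrC.
Qed.

Lemma norm_e2pii z : `|e2pii z| = creal (expR (- (2 * pi * im z))).
Proof.
rewrite /e2pii /cexp [LHS]normrM.
have -> : `|cpair (cos (im (cpair 0 (2 * pi) * z)))
              (sin (im (cpair 0 (2 * pi) * z)))| = 1 :> C.
  by rewrite [LHS](@normc_def R (cpair _ _)) /= cos2Dsin2 sqrtr1.
rewrite mulr1 [LHS](@normc_def R (creal _)) /= expr0n addr0 sqrtr_sqr.
rewrite ger0_norm ?expR_ge0//.
by case: z => a b; rewrite /re /im /= mul0r sub0r.
Qed.

Lemma cvg_creal_bound (T : Type) (F : set_system T) {FF : Filter F}
    (u : T -> C) (l : C) :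
  (forall x, 0 < x -> \forall n \near F, `|l - u n| <= creal x) -> u @ F --> l.
Proof.
move=> ul; apply/cvgrPdist_le => e e0.
have [x x0 ex] := creal_norm e.
rewrite (gtr0_norm e0) in ex; rewrite ex; apply: ul.
by rewrite -ltr_creal -ex.
Qed.

End ComplexExponential.

(** * Power series *)

Section PowerSeries.
Variable R : realType.
Local Notation C := (cplx R).
Local Notation creal := (@creal R).
Implicit Types (z w t u : C) (x y : R).

(** Each of the [n] terms of the geometric sum of the [x ^+ i], [i < n], is at least [x ^+ n], and
    the whole sum is at most [(1 - x)^-1]. *)
Lemma natmul_exp_bounded (x : R) (n : nat) :
  0 <= x -> x < 1 -> n%:R * x ^+ n <= (1 - x)^-1.
Proof.
move=> x0 x1; have x1' : 0 < 1 - x by rewrite subr_gt0.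
rewrite -(ler_pM2r x1') mulVf ?gt_eqF//.
have geo : (\sum_(i < n) x ^+ i) * (1 - x) = 1 - x ^+ n.
  by rewrite -[RHS]opprB subrX1; ring.
apply: (@le_trans _ _ (1 - x ^+ n)); last by rewrite gerBl exprn_ge0.
rewrite -geo ler_pM2r// mulrC mulr_natr -[n in _ *+ n]card_ord -sumr_const.
apply: ler_sum => i _; rewrite ler_wiXn2l ?(ltW x1)//.
exact/ltnW/ltn_ord.
Qed.

Lemma cvg_sqrn_exp (x : R) : 0 <= x -> x < 1 ->
  (fun n => n%:R ^+ 2 * x ^+ n) @ \oo --> (0 : R).
Proof.
(* With [s] the cube root of [x], the sequence is [(n s^n)^2 s^n]: a bounded factor times a
   geometric one. *)
move=> x0 x1; pose s : R := x `^ 3^-1.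
have s0 : 0 <= s by exact: powR_ge0.
have s3 : s ^+ 3 = x.
  by rewrite -powR_mulrn// -powRrM mulVf ?powRr1// pnatr_eq0.
have s1 : s < 1 by rewrite -(@expr_lt1 _ 3)// s3.
have sn : (fun n => (1 - s)^-1 ^+ 2 * s ^+ n) @ \oo --> (0 : R).
  by apply: cvg_geometric; rewrite ger0_norm.
apply: (squeeze_cvgr _ (cvg_cst 0) sn); apply: nearW => n.
rewrite mulr_ge0 ?exprn_ge0//=.
have -> : n%:R ^+ 2 * x ^+ n = (n%:R * s ^+ n) ^+ 2 * s ^+ n.
  by rewrite -[in LHS]s3 -exprM mulnC exprM; ring.
rewrite ler_wpM2r ?exprn_ge0// lerXn2r ?natmul_exp_bounded//.
  by rewrite nnegrE mulr_ge0 ?exprn_ge0.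
by rewrite nnegrE invr_ge0 subr_ge0 ltW.
Qed.

(** The terms tend to 0. Applied to a Fourier series at a base point [t0], this supplies the growth
    bound on the coefficients. *)
Lemma cvg_series_bounded (u : nat -> C) (l : C) :
  series u @ \oo --> l -> exists2 M : C, 0 < M & forall n, `|u n| <= M.
Proof.
move=> ul; have /cvg_series_cvg_0 u0 : cvgn (series u) by apply/cvg_ex; exists l.
have /cvg_seq_bounded/pinfty_ex_gt0[M M0 uM] : cvgn u by apply/cvg_ex; exists 0.
by exists M => // n; apply: uM.
Qed.

(** The tail is dominated by a geometric series of ratio at most 1/2, whose sum is at most twice its
    first term [M * |y|]. *)
Lemma series_dist_head (u : nat -> C) (M y g : C) :
    (forall n, `|u n| <= M) -> `|y| <= 2^-1 ->
  series (fun n => u n * y ^+ n) @ \oo --> g -> `|g - u 0%N| <= 2 * M * `|y|.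
Proof.
move=> uM y2 ug.
have M0 : 0 <= M by apply: le_trans (uM 0%N); exact: normr_ge0.
(* The factor [1 - |y|^n] makes the induction work: its increment pays for the new term
   [M |y|^(n+1)] exactly when [|y| <= 1/2]. *)
have bnd n : `|series (fun n => u n * y ^+ n) n.+1 - u 0%N|
    <= 2 * M * `|y| * (1 - `|y| ^+ n).
  elim: n => [|n IHn].
    by rewrite /series/= big_nat1 expr0 mulr1 subrr normr0 subrr mulr0.
  rewrite /series/= big_nat_recr//= addrAC.
  apply: le_trans (ler_normD _ _) _.
  apply: le_trans (lerD IHn _) _; first exact: lexx.
  rewrite normrM normrX.
  have : `|u n.+1| * `|y| ^+ n.+1 <= M * `|y| ^+ n.+1.
    by rewrite ler_wpM2r ?exprn_ge0.
  move=> /(lerD (lexx (2 * M * `|y| * (1 - `|y| ^+ n))))/le_trans; apply.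
  rewrite -subr_ge0.
  have -> : 2 * M * `|y| * (1 - `|y| ^+ n.+1) - (2 * M * `|y| * (1 - `|y| ^+ n)
     + M * `|y| ^+ n.+1) = M * `|y| ^+ n.+1 * (2 * (2^-1 - `|y|)).
    have -> : 2 * (2^-1 - `|y|) = 1 - 2 * `|y|.
      by rewrite mulrBr divff// pnatr_eq0.
    by rewrite exprS; ring.
  by rewrite !mulr_ge0 ?exprn_ge0 ?subr_ge0// ler0n.
apply/ler_addgt0Pr => e e0.
have /cvgrPdist_le/(_ e e0) [N _ /(_ N.+1 (leqnSn _))/= dN] := ug.
apply: le_trans (ler_distD (series (fun n => u n * y ^+ n) N.+1) _ _) _.
rewrite addrC; apply: lerD; last exact: dN.
apply: le_trans (bnd N) _.
by rewrite ler_piMr ?mulr_ge0// ?ler0n// gerBl exprn_ge0.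
Qed.

(** The triangle [i + j < N] is summed by antidiagonals on the left and by rows on the right. *)
Lemma sum_cauchy_product (K : comPzRingType) (u v : nat -> K) N :
  \sum_(0 <= n < N) \sum_(0 <= i < n.+1) u i * v (n - i)%N =
  \sum_(0 <= i < N) u i * \sum_(0 <= j < N - i) v j.
Proof.
elim: N => [|N IHN]; first by rewrite !big_nil.
rewrite big_nat_recr//= IHN [RHS]big_nat_recr//= subSnn big_nat1.
rewrite [X in _ + X = _]big_nat_recr//= subnn addrA -big_split/=.
congr (_ + _); apply: eq_big_nat => i /andP[_ iN].
by rewrite subSn 1?ltnW// big_nat_recr//= mulrDr.
Qed.

(* The square of partial sums and the triangle of the Cauchy product differ by
   at most N ^ 2 terms, each of which is O(x ^ N). *)
Lemma cvg_cauchy_product (u v : nat -> C) (x : R) (M k l : C) :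
    0 <= x -> x < 1 ->
    (forall n, `|u n| <= M * creal x ^+ n) ->
    (forall n, `|v n| <= M * creal x ^+ n) ->
    series u @ \oo --> k -> series v @ \oo --> l ->
  series (fun n => \sum_(0 <= i < n.+1) u i * v (n - i)%N) @ \oo --> k * l.
Proof.
move=> x0 x1 uM vM uk vl.
have cx0 : 0 <= creal x by rewrite -[0]/(creal 0) ler_creal.
have cx1 : creal x <= 1 by rewrite -[1]/(creal 1) ler_creal ltW.
have M0 : 0 <= M.
  by have := uM 0%N; rewrite expr0 mulr1; apply: le_trans; exact: normr_ge0.
have [m _ Mm] := creal_norm _ M; rewrite (ger0_norm M0) in Mm.
have diff N : `|series u N * series v N
   - series (fun n => \sum_(0 <= i < n.+1) u i * v (n - i)%N) N|
   <= creal (m ^+ 2 * (N%:R ^+ 2 * x ^+ N)).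
  rewrite /series/= sum_cauchy_product mulr_suml -sumrB.
  have -> : creal (m ^+ 2 * (N%:R ^+ 2 * x ^+ N)) =
    \sum_(0 <= i < N) (N%:R * (M ^+ 2 * creal x ^+ N)).
    rewrite sumr_const_nat subn0 -[RHS]mulr_natl Mm crealM.
    by rewrite (crealM _ (N%:R ^+ 2)) (crealX _ m) (crealX _ N%:R) (crealX _ x) creal_nat; ring.
  apply: le_trans (ler_norm_sum _ _ _) _.
  apply: ler_sum_nat => i /andP[_ iN].
  (* In row [i], the square exceeds the triangle by the columns [N - i <= j < N], where
     [i + j >= N]. *)
  rewrite -mulrBr (@big_cat_nat _ _ _ (N - i))//= ?leq_subr// [X in X - _]addrC addrK.
  rewrite mulr_sumr; apply: le_trans (ler_norm_sum _ _ _) _.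
  apply: (@le_trans _ _ (\sum_(N - i <= j < N) (M ^+ 2 * creal x ^+ N))).
    apply: ler_sum_nat => j /andP[iNj jN].
    rewrite normrM; apply: le_trans (ler_pM (normr_ge0 _) (normr_ge0 _) (uM i) (vM j)) _.
    rewrite mulrACA -expr2 -exprD ler_wpM2l ?exprn_ge0//.
    by rewrite ler_wiXn2l//; lia.
  rewrite sumr_const_nat -[leLHS]mulr_natl ler_wpM2r ?mulr_ge0 ?exprn_ge0//.
  by rewrite ler_nat leq_subr.
have -> : series (fun n => \sum_(0 <= i < n.+1) u i * v (n - i)%N) =
  (fun N => series u N * series v N - (series u N * series v N
   - series (fun n => \sum_(0 <= i < n.+1) u i * v (n - i)%N) N)).
  by apply/funext => N; rewrite opprB addrC subrK.
have kl : (fun N => series u N * series v N) @ \oo --> k * l by exact: (cvgM uk vl).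
rewrite -[k * l]subr0; apply: (cvgB kl).
apply: cvg_creal_bound => e e0.
have /cvgrPdist_le/(_ e e0) : (fun N => m ^+ 2 * (N%:R ^+ 2 * x ^+ N)) @ \oo --> (0 : R).
  by rewrite -[0](mulr0 (m ^+ 2)); apply: cvgM; [exact: cvg_cst | exact: cvg_sqrn_exp].
apply: filterS => N; rewrite !sub0r !normrN => eN.
apply: le_trans (diff N) _; rewrite ler_creal.
by apply: le_trans eN; exact: ler_norm.
Qed.

End PowerSeries.

(** * Fourier expansions *)

(** The Moebius action of the matrix [[a, b], [0, d]]. *)
Definition affine {R : realType} (a b d : nat) (t : cplx R) : cplx R :=
  (a%:R * t + b%:R) / d%:R.

Lemma affine_continuous (K : numFieldType) (x y d : K) :
  continuous (fun t : K => (x * t + y) / d).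
Proof.
move=> z.
have c (k : K) : cst k t @[t --> z] --> k := @cvg_cst K k K (nbhs z) (nbhs_filter z).
have c1 := @cvgM K K _ (nbhs_filter z) (cst x) id x z (c x) (@cvg_id _ _).
have c2 := @cvgD K K K _ (nbhs_filter z) _ _ _ _ c1 (c y).
have c3 := @cvgM K K _ (nbhs_filter z) _ _ _ _ c2 (c d^-1).
exact: c3.
Qed.

Section FourierExpansions.
Variable R : realType.
Local Notation C := (cplx R).
Local Notation creal := (@creal R).
Implicit Types (z t : C) (w : nat) (x y : R) (F G : C -> C).

Lemma im_affine a b d t : im (affine a b d t) = a%:R / d%:R * im t.
Proof.
rewrite /affine -creal_nat -(creal_nat _ b) -(creal_nat _ d) -crealV mulrC.
by rewrite im_crealM imD im_crealM addr0 mulrA [_^-1 * _]mulrC.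
Qed.

Lemma affine_inj a b d : (0 < a)%N -> (0 < d)%N -> injective (@affine R a b d).
Proof.
move=> a0 d0 s t /mulIf; rewrite invr_eq0 pnatr_eq0 -lt0n => /(_ d0)/addIr.
by apply: mulfI; rewrite pnatr_eq0 -lt0n.
Qed.

Lemma cvg_affine a b d z : @affine R a b d t @[t --> z] --> affine a b d z.
Proof. exact: affine_continuous. Qed.

(** Continuity pulls neighbourhoods back, and injectivity keeps the puncture at [z] only. *)
Lemma near_affine a b d z (P : set C) : (0 < a)%N -> (0 < d)%N ->
  (\forall u \near (affine a b d z)^', P u) ->
  \forall t \near z^', P (affine a b d t).
Proof.
move=> a0 d0 Pw.
have {}Pw : \forall u \near affine a b d z, u != affine a b d z -> P u by exact: Pw.
have {}Pw : \forall t \near z, affine a b d t != affine a b d z -> P (affine a b d t).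
  exact: (cvg_affine a b d z _ Pw).
near=> t; have tz : t != z by near: t; exact: nbhs_dnbhs_neq.
have : affine a b d t != affine a b d z.
  by apply: contra_neq tz; exact: (affine_inj a b d a0 d0).
by near: t; apply: nbhs_dnbhs.
Unshelve. all: by end_near. Qed.

Lemma near_im_gt y z : y < im z -> \forall t \near z, y < im t.
Proof.
move=> yz; have e0 : 0 < creal (im z - y) by rewrite -[0]/(creal 0) ltr_creal subr_gt0.
apply/nbhs_ballP; exists (creal (im z - y)) => //= t.
rewrite /ball/= => zt; have : creal `|im z - im t| <= `|z - t|.
  case: (z) (t) => [a b] [c d].
  rewrite [`|Complex a b - _|](@normc_def R (_ +i* _)) ler_creal /im/=.
  by rewrite -sqrtr_sqr ler_wsqrtr// lerDr sqr_ge0.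
move=> /le_lt_trans/(_ zt); rewrite ltr_creal => /(le_lt_trans (ler_norm _)).
by rewrite ltrD2l ltrN2.
Qed.

Lemma near_dnbhs_im_gt y z : y < im z -> \forall t \near z^', y < im t.
Proof. by move=> /near_im_gt; exact: nbhs_dnbhs. Qed.

(** Change of base point: a Fourier series at [t] becomes a power series in [e2pii ((t - t0) / w)]
    whose coefficients are the terms of the series at [t0]. *)
Lemma e2pii_expansionX w n (t t0 : C) :
  e2pii (n%:R / w%:R * t) =
  e2pii (n%:R / w%:R * t0) * e2pii (w%:R^-1 * (t - t0)) ^+ n.
Proof. by rewrite -e2piiX -e2piiD; congr e2pii; ring. Qed.

Lemma norm_e2pii_scale w t :
  `|e2pii (w%:R^-1 * t)| = creal (expR (- (2 * pi * (w%:R^-1 * im t)))).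
Proof. by rewrite norm_e2pii -creal_nat -crealV im_crealM. Qed.

(* The limit of e2pii (- h t) F t at i oo: the exponent h and the leading
   coefficient are recovered from it. *)
Lemma fourier_expansion_limit w h a F x : (0 < w)%N -> 0 < x ->
  fourier_expansion w h a F ->
  exists Y, forall z, Y < im z -> \forall t \near z^',
    `|e2pii (creal (- h) * t) * F t - a 0%N| <= creal x.
Proof.
move=> w0 x0 [Y [g [ag Fg]]].
pose t0 : C := cpair 0 (Y + 1).
have [M M0 aM] : exists2 M : C, 0 < M & forall n, `|a n * e2pii (n%:R / w%:R * t0)| <= M.
  by apply: (@cvg_series_bounded _ _ (g t0)); apply: ag; rewrite /im/= ltrDl.
have [m m0 Mm] := creal_norm _ M; rewrite (gtr0_norm M0) in Mm.
have {}m0 : 0 < m by rewrite -ltr_creal -Mm.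
(* [c] bounds the power series variable [s]: 1/2 is required by [series_dist_head], and [x / (2 m)]
   makes its bound [2 M |s|] at most [x]. The height [Y'] is where
   [exp (- 2 pi (im t - Y - 1) / w)], the norm of [s], drops to [c]. *)
pose c := Num.min 2^-1 (x / (2 * m)).
have c0 : 0 < c.
  by rewrite lt_min invr_gt0 ltr0n divr_gt0// mulr_gt0.
pose Y' := Num.max (Y + 1) (Y + 1 - w%:R * ln c / (2 * pi)).
have Y'Y : Y < Y' by rewrite lt_max ltrDl ltr01.
exists Y' => z Yz.
have zY : Y < im z by exact: lt_trans Yz.
near=> t.
have tY' : Y' < im t by near: t; exact: near_dnbhs_im_gt.
have tY : Y < im t by exact: lt_trans tY'.
have -> : F t = e2pii (creal h * t) * g t by near: t; exact: Fg.
rewrite mulrA -e2piiD -mulrDl -crealD addNr mul0r e2pii0 mul1r.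
have := ag t tY.
under [X in series X]eq_fun => n do
  rewrite (e2pii_expansionX _ _ _ t0) mulrA.
set s := e2pii _.
have sc : `|s| <= creal c.
  rewrite norm_e2pii_scale ler_creal -[leRHS]lnK ?posrE// ler_expR.
  have : Y + 1 - w%:R * ln c / (2 * pi) < im t.
    by apply: le_lt_trans tY'; rewrite le_max lexx orbT.
  have tw : 0 < (w%:R : R) by rewrite ltr0n.
  have pi0 : 0 < 2 * (pi : R) by rewrite mulr_gt0// pi_gt0.
  have -> : im (t - t0) = im t - (Y + 1) by rewrite imD.
  move=> /ltW lt.
  move: (2 * pi) pi0 lt => q q0 lt.
  have -> : ln c = - (q * (w%:R^-1 * - (w%:R * ln c / q))).
    by field; rewrite !gt_eqF.
  rewrite lerN2 (ler_pM2l q0) ler_pM2l ?invr_gt0//.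
  by lra.
move=> /series_dist_head => /(_ _ aM); rewrite mul0r mul0r e2pii0 mulr1.
move=> H; apply: le_trans (H _) _.
  by apply: le_trans sc _; rewrite -(creal_nat _ 2) -crealV ler_creal ge_min lexx.
rewrite Mm -(creal_nat _ 2) -crealM.
apply: (@le_trans _ _ (creal (2 * m) * creal c)).
  by rewrite ler_wpM2l// -[0]/(creal 0) ler_creal ltW// mulr_gt0.
by rewrite -crealM ler_creal mulrC -ler_pdivlMr ?mulr_gt0// ge_min lexx orbT.
Unshelve. all: by end_near. Qed.

End FourierExpansions.

(** * Operations on Fourier expansions *)

Section LeadingCoefficients.
Variable R : realType.
Local Notation C := (cplx R).
Local Notation creal := (@creal R).
Implicit Types (z t : C) (w : nat) (x y : R) (F G : C -> C).

Lemma fourier_expansion_mero_eq w h a F G :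
  mero_eq (@uhp R) F G -> fourier_expansion w h a F -> fourier_expansion w h a G.
Proof.
(* [F] and [G] are compared on the upper half-plane only, so the height must be at least 0. *)
move=> FG [Y [g [ag Fg]]]; exists (Num.max Y 0), g; split=> [t|z /=].
  by rewrite gt_max => /andP[/ag].
rewrite gt_max => /andP[zY z0].
near=> t.
have <- : F t = G t by near: t; exact: FG.
by near: t; exact: Fg.
Unshelve. all: by end_near. Qed.

Lemma fourier_expansionZ (c : C) w h a F :
  fourier_expansion w h a F ->
  fourier_expansion w h (fun n => c * a n) (fun t => c * F t).
Proof.
move=> [Y [g [ag Fg]]]; exists Y, (fun t => c * g t); split=> [t tY|z zY].
  have -> : series (fun n => c * a n * e2pii (n%:R / w%:R * t)) =
      (fun N => c * series (fun n => a n * e2pii (n%:R / w%:R * t)) N).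
    apply/funext => N; rewrite /series/= mulr_sumr.
    by apply: eq_bigr => i _; rewrite mulrA.
  have cc : (fun _ : nat => c) @ \oo --> c := @cvg_cst _ c _ _ eventually_filter.
  exact: (cvgM cc (ag t tY)).
near=> t.
rewrite mulrCA; congr (c * _).
by near: t; exact: Fg.
Unshelve. all: by end_near. Qed.

Lemma fourier_expansionM w h h' a b F G : (0 < w)%N ->
    fourier_expansion w h a F -> fourier_expansion w h' b G ->
  fourier_expansion w (h + h') (fun n => \sum_(0 <= i < n.+1) a i * b (n - i)%N)
    (fun t => F t * G t).
Proof.
move=> w0 [Y1 [f [af Ff]]] [Y2 [g [bg Gg]]].
pose Y := Num.max Y1 Y2.
exists Y, (fun t => f t * g t); split=> [t tY|z]; last first.
  rewrite /= gt_max => /andP[z1 z2]; near=> t.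
  have -> : F t = e2pii (creal h * t) * f t by near: t; exact: Ff.
  have -> : G t = e2pii (creal h' * t) * g t by near: t; exact: Gg.
  by rewrite crealD mulrDl e2piiD mulrACA.
(* [t0] lies strictly between height [Y] and [t]: both series have bounded terms at [t0], hence
   terms decaying like [x ^ n] at [t] with [x < 1], as the Cauchy product requires. *)
pose t0 := cpair 0 ((im t + Y) / 2) : C.
have t0E : im t0 = (im t + Y) / 2 by [].
have t0Y : Y < im t0 by rewrite t0E; lra.
have t0t : im t0 < im t by rewrite t0E; lra.
have [M M0 aM] : exists2 M : C, 0 < M & forall n, `|a n * e2pii (n%:R / w%:R * t0)| <= M.
  by apply: cvg_series_bounded; apply: af; apply: le_lt_trans t0Y; rewrite le_max lexx.
have [M' M'0 bM] : exists2 M : C, 0 < M & forall n, `|b n * e2pii (n%:R / w%:R * t0)| <= M.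
  by apply: cvg_series_bounded; apply: bg; apply: le_lt_trans t0Y; rewrite le_max lexx orbT.
pose s := e2pii (w%:R^-1 * (t - t0)).
pose x := expR (- (2 * pi * (w%:R^-1 * im (t - t0)))).
have x1 : x < 1.
  rewrite expR_lt1 oppr_lt0 !mulr_gt0 ?pi_gt0 ?invr_gt0 ?ltr0n//.
  by rewrite imD subr_gt0.
have bound c N : (forall n, `|c n * e2pii (n%:R / w%:R * t0)| <= N) -> forall n,
    `|c n * e2pii (n%:R / w%:R * t)| <= N * creal x ^+ n.
  move=> cN n; rewrite (e2pii_expansionX _ _ _ t t0) mulrA normrM normrX norm_e2pii_scale.
  by apply: ler_wpM2r; [rewrite exprn_ge0// -[0]/(creal 0) ler_creal expR_ge0 | exact: cN].
have cx0 n : 0 <= creal x ^+ n.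
  by rewrite exprn_ge0// -[0]/(creal 0) ler_creal expR_ge0.
have tY1 : Y1 < im t by apply: le_lt_trans tY; rewrite le_max lexx.
have tY2 : Y2 < im t by apply: le_lt_trans tY; rewrite le_max lexx orbT.
have := cvg_cauchy_product _ _ _ x (M + M') _ _ (expR_ge0 _) x1 _ _ (af t tY1) (bg t tY2).
set S1 := series _; set S2 := series _.
have -> : S1 = S2.
  apply/funext => N; apply: eq_bigr => n _; rewrite mulr_suml.
  apply: eq_big_nat => i /andP[_]; rewrite ltnS => ni.
  rewrite mulrACA -e2piiD -!mulrDl -natrD subnKC//.
apply=> n.
  by apply: le_trans (bound _ _ aM n) _; rewrite ler_wpM2r// lerDl ltW.
by apply: le_trans (bound _ _ bM n) _; rewrite ler_wpM2r// lerDr ltW.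
Unshelve. all: by end_near. Qed.

(** [(N + A.-1) %/ A] is [N / A] rounded up, the number of multiples of [A] below [N]. *)
Lemma sum_spread (K : nmodType) (u : nat -> K) A N : (0 < A)%N ->
  \sum_(0 <= m < N) (if (A %| m)%N then u (m %/ A)%N else 0) =
  \sum_(0 <= n < (N + A.-1) %/ A) u n.
Proof.
case: A => // A _; elim: N => [|N IHN].
  by rewrite big_nil divn_small ?big_nil// add0n.
rewrite big_nat_recr//= IHN addSnnS; case: ifP => [/dvdnP[k ->]|AN].
  by rewrite mulnK// !divnMDl// divnn divn_small//= addn0 addn1 big_nat_recr.
rewrite addr0; congr (\sum_(0 <= i < _) u i).
have := divn_eq N A.+1; have := ltn_pmod N (ltn0Sn A).
have : (N %% A.+1 != 0)%N by move: AN; rewrite /dvdn => ->.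
move: (N %% _)%N (N %/ _)%N => r k r0 rA ->.
rewrite -!addnA !divnMDl//.
have -> : (r + A.+1 = 1 * A.+1 + r)%N by lia.
have -> : (r + A = 1 * A.+1 + r.-1)%N by lia.
by rewrite !divnMDl// !divn_small//; lia.
Qed.

(** The substitution turns [q ^ (n / w)] into a constant times [q ^ (n A / (w D))], so the
    coefficient of index [n] moves to index [n A] and the other indices get 0. The factor in [h]
    comes from the shift [q ^ h]. *)
Lemma fourier_expansion_affine w h a F A B D :
    (0 < w)%N -> (0 < A)%N -> (0 < D)%N -> fourier_expansion w h a F ->
  fourier_expansion (w * D) (h * A%:R / D%:R)
    (fun m => if (A %| m)%N then
       e2pii (creal h * (B%:R / D%:R)) *
       (a (m %/ A)%N * e2pii ((m %/ A)%:R / w%:R * (B%:R / D%:R))) else 0)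
    (fun t => F (affine A B D t)).
Proof.
move=> w0 A0 D0 [Y [g [ag Fg]]].
have [A0' D0'] : 0 < A%:R :> R /\ 0 < D%:R :> R by rewrite !ltr0n.
pose c : C := e2pii (creal h * (B%:R / D%:R)).
have imY t : Y * D%:R / A%:R < im t -> Y < im (affine A B D t).
  by rewrite ltr_pdivrMr// im_affine mulrAC [A%:R * _]mulrC ltr_pdivlMr.
exists (Y * D%:R / A%:R), (fun t => c * g (affine A B D t)); split=> [t|z] tY.
  have /= {}ag := ag _ (imY _ tY).
  set S := series _.
  (* The partial sums are, up to [c], those of the original series at an index that tends to
     infinity with [N]. *)
  have -> : S = (fun N => c * series (fun n => a n *
      e2pii (n%:R / w%:R * affine A B D t)) ((N + A.-1) %/ A)%N).
    apply/funext => N; rewrite /series/= -sum_spread// mulr_sumr.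
    apply: eq_bigr => m _; case: ifP => [/dvdnP[k ->]|]; last by rewrite mul0r mulr0.
    rewrite mulnK// -mulrA; congr (_ * _); rewrite -mulrA -e2piiD; congr (_ * e2pii _).
    rewrite /affine !natrM; field.
    by rewrite !pnatr_eq0 -!lt0n w0 ?A0 ?D0.
  have cc : (fun _ : nat => c) @ \oo --> c := @cvg_cst _ c _ _ eventually_filter.
  apply: (cvgM cc).
  apply: (cvg_comp _ _ _ ag) => U [N _ NU]; exists (A * N)%N => //= n /= Nn.
  by apply: NU => /=; rewrite leq_divRL// mulnC; lia.
have /(near_affine R A B D z _ A0 D0) := Fg _ (imY _ tY).
apply: filterS => t ->.
rewrite mulrA -e2piiD; congr (e2pii _ * _).
rewrite /affine !crealM crealV !creal_nat; field.
by rewrite pnatr_eq0 -lt0n.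
Qed.

End LeadingCoefficients.

(** * Leading coefficients *)

Section LeadingCoefficientAlgebra.
Variable R : realType.
Local Notation C := (cplx R).
Local Notation creal := (@creal R).
Implicit Types (z t c d k : C) (w : nat) (x y h : R) (F G : C -> C).

Lemma norm_le_small z : (forall x, 0 < x -> `|z| <= creal x) -> z = 0.
Proof.
have [n n0 zn] := creal_norm R z; rewrite zn => nx.
apply/eqP; rewrite -normr_eq0 zn creal_eq0 eq_le n0 andbT.
by apply/ler_addgt0Pr => e e0; rewrite add0r -ler_creal; exact: nx.
Qed.

(** For [h' = h] both constants are limits of the same function. For [h' < h] the second function is
    the first one times [e2pii ((h - h') t)], so it tends to 0, against [d != 0]. *)
Lemma leading_coef_unique_le h h' c d F : h' <= h -> d != 0 ->
  (forall x, 0 < x -> exists Y, forall z, Y < im z -> \forall t \near z^',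
    `|e2pii (creal (- h) * t) * F t - c| <= creal x) ->
  (forall x, 0 < x -> exists Y, forall z, Y < im z -> \forall t \near z^',
    `|e2pii (creal (- h') * t) * F t - d| <= creal x) -> c = d.
Proof.
move=> hh d0 cF dF.
have point x Y : 0 < x -> exists t, [/\ Y < im t,
    `|e2pii (creal (- h) * t) * F t - c| <= creal x &
    `|e2pii (creal (- h') * t) * F t - d| <= creal x].
  move=> x0; have [Y1 c1] := cF x x0; have [Y2 d1] := dF x x0.
  have [z] : exists z : C, Num.max (Num.max Y1 Y2) Y < im z.
    by exists (cpair 0 (Num.max (Num.max Y1 Y2) Y + 1)); rewrite ltrDl.
  rewrite !gt_max => /andP[/andP[z1 z2] z3].
  have := filter_ex (filterI (near_dnbhs_im_gt R _ _ z3) (filterI (c1 z z1) (d1 z z2))).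
  by case=> t [? [? ?]]; exists t.
have [hE|hne] := eqVneq h' h.
  apply/subr0_eq/norm_le_small => x x0.
  have [|t [_]] := point (x / 2) 0; first by rewrite divr_gt0.
  rewrite hE distrC => c1 d1.
  apply: le_trans (ler_distD (e2pii (creal (- h) * t) * F t) _ _) _.
  by apply: le_trans (lerD c1 d1) _; rewrite -crealD -splitr.
have {hne hh} hlt : 0 < h - h' by rewrite subr_gt0 lt_neqAle hne.
suff : d = 0 by move/eqP: d0.
have [n n0 cn] := creal_norm R c.
apply: norm_le_small => x x0.
(* The first function is at most [n + x / 2] in norm, and [y] is the size of the extra exponential
   that brings the product down to [x / 2]. The height below enforces that size. *)
pose y := x / 2 / (n + x / 2).
have x20 : 0 < x / 2 by rewrite divr_gt0.
have nx0 : 0 < n + x / 2 by rewrite ltr_wpDl.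
have y0 : 0 < y by rewrite divr_gt0.
have pi20 : 0 < 2 * (pi : R) by rewrite mulr_gt0// pi_gt0.
have [t [tY c1 d1]] := point _ (- ln y / (2 * pi * (h - h'))) x20.
have ey : `|e2pii (creal (h - h') * t)| <= creal y.
  rewrite norm_e2pii ler_creal -[leRHS]lnK ?posrE// ler_expR im_crealM.
  by rewrite lerNl mulrA mulrC -ler_pdivrMr; [exact: ltW | exact: mulr_gt0].
have split_t : e2pii (creal (- h') * t) * F t =
    e2pii (creal (h - h') * t) * (e2pii (creal (- h) * t) * F t).
  rewrite mulrA -e2piiD -mulrDl -crealD.
  by have -> : h - h' + - h = - h' by rewrite addrAC subrr sub0r.
have c2 : `|e2pii (creal (- h) * t) * F t| <= creal (n + x / 2).
  have := le_trans (ler_normD _ c) (lerD c1 (lexx `|c|)).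
  by rewrite subrK cn -crealD addrC.
have c3 : `|e2pii (creal (- h') * t) * F t| <= creal (y * (n + x / 2)).
  by rewrite split_t normrM crealM; exact: ler_pM (normr_ge0 _) (normr_ge0 _) ey c2.
have := ler_normD (d - e2pii (creal (- h') * t) * F t) (e2pii (creal (- h') * t) * F t).
rewrite subrK distrC => /le_trans; apply; apply: le_trans (lerD d1 c3) _.
by rewrite -crealD /y divfK ?gt_eqF// -splitr.
Qed.

Lemma leading_coef_mero_eq c F G : mero_eq (@uhp R) F G ->
  is_leading_coef F c -> is_leading_coef G c.
Proof.
move=> FG [c0 [w [h [a [w0 Fa ac]]]]]; split=> //; exists w, h, a; split=> //.
exact: fourier_expansion_mero_eq Fa.
Qed.

Lemma leading_coef_unique c d F :
  is_leading_coef F c -> is_leading_coef F d -> c = d.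
Proof.
move=> [c0 [w [h [a [w0 Fa ac]]]]] [d0 [w' [h' [b [w'0 Fb bd]]]]].
rewrite -ac -bd in c0 d0 *.
have La x (xp : 0 < x) := fourier_expansion_limit _ _ _ _ _ x w0 xp Fa.
have Lb x (xp : 0 < x) := fourier_expansion_limit _ _ _ _ _ x w'0 xp Fb.
have [hh|/ltW hh] := leP h' h; first exact: leading_coef_unique_le La Lb.
by apply/esym; exact: leading_coef_unique_le Lb La.
Qed.

Lemma leading_coefZ k c F : k != 0 ->
  is_leading_coef F c -> is_leading_coef (fun t => k * F t) (k * c).
Proof.
move=> k0 [c0 [w [h [a [w0 Fa ac]]]]]; split; first exact: mulf_neq0.
by exists w, h, (fun n => k * a n); rewrite ac; split=> //; exact: fourier_expansionZ.
Qed.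

Lemma leading_coef1 : is_leading_coef (fun _ : C => 1) 1.
Proof.
split; first exact: oner_neq0.
exists 1%N, 0, (fun n => (n == 0%N)%:R); split=> //.
exists 0, (fun=> 1); split=> [t _|z _]; last first.
  by apply: nearW => t; rewrite -[creal 0]/(0 : C) mul0r e2pii0 mulr1.
apply: cvg_creal_bound => x x0; exists 1%N => // -[//|n] _.
rewrite /series/= big_nat_recl//= big1 => [|i _]; last by rewrite mul0r.
rewrite addr0 mul1r mul0r mul0r e2pii0 subrr normr0 -[0]/(creal 0) ler_creal.
exact: ltW.
Qed.

(** Index 0 is a multiple of [A], so it keeps [c] up to exponential factors. Existence suffices
    because Hecke images are normalized afterwards. *)
Lemma leading_coef_affine A B D c F : (0 < A)%N -> (0 < D)%N ->
  is_leading_coef F c -> exists d, is_leading_coef (fun t => F (affine A B D t)) d.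
Proof.
move=> A0 D0 [c0 [w [h [a [w0 Fa ac]]]]].
exists (e2pii (creal h * (B%:R / D%:R)) *
  (c * e2pii (0%:R / w%:R * (B%:R / D%:R)))); split.
  by rewrite mulf_neq0// ?e2pii_neq0// mulf_neq0// e2pii_neq0.
exists (w * D)%N; do 2 eexists; split; first by rewrite muln_gt0 w0.
  exact: (fourier_expansion_affine _ _ _ _ _ A B D w0 A0 D0 Fa).
by rewrite /= div0n dvdn0 ac.
Qed.

(** The matrix [[D, 0], [0, D]] acts as the identity. This brings two expansions to a common
    denominator before they are multiplied. *)
Lemma fourier_expansion_widen w h a F D : (0 < w)%N -> (0 < D)%N ->
  fourier_expansion w h a F ->
  exists b, b 0%N = a 0%N /\ fourier_expansion (w * D) h b F.
Proof.
move=> w0 D0 /(fourier_expansion_affine _ _ _ _ _ D 0 D w0 D0 D0).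
rewrite mulfK ?pnatr_eq0 -?lt0n// => FE.
have DC : (D%:R : C) != 0 by rewrite pnatr_eq0 -lt0n.
have FF : (fun t => F (affine D 0 D t)) = F.
  by apply/funext => t; rewrite /affine addr0 mulrC mulKf.
rewrite FF in FE; eexists; split; last exact: FE.
by rewrite /= dvdn0 div0n !mul0r !mulr0 e2pii0 mul1r mulr1.
Qed.

Lemma leading_coefM c d F G : is_leading_coef F c -> is_leading_coef G d ->
  is_leading_coef (fun t => F t * G t) (c * d).
Proof.
move=> [c0 [w [h [a [w0 Fa ac]]]]] [d0 [w' [h' [b [w'0 Gb bd]]]]].
split; first by rewrite mulf_neq0.
have [a' [a'0 Fa']] := fourier_expansion_widen _ _ _ _ _ w0 w'0 Fa.
have [b' [b'0 Gb']] := fourier_expansion_widen _ _ _ _ _ w'0 w0 Gb.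
rewrite mulnC in Gb'.
have ww0 : (0 < w * w')%N by rewrite muln_gt0 w0.
exists (w * w')%N; do 2 eexists; split=> //.
  exact: (fourier_expansionM _ _ _ _ _ _ _ _ ww0 Fa' Gb').
by rewrite /= big_nat1 a'0 b'0 ac bd.
Qed.

Lemma leading_coef_prod (I : eqType) (r : seq I) (F : I -> C -> C) (c : I -> C) :
  (forall i, i \in r -> is_leading_coef (F i) (c i)) ->
  is_leading_coef (fun t => \prod_(i <- r) F i t) (\prod_(i <- r) c i).
Proof.
elim: r => [|i r IHr] Fc.
  rewrite big_nil; have -> : (fun t => \prod_(i <- [::]) F i t) = fun=> 1.
    by apply/funext => t; rewrite big_nil.
  exact: leading_coef1.
rewrite big_cons; have -> : (fun t => \prod_(j <- i :: r) F j t) =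
    fun t => F i t * \prod_(j <- r) F j t.
  by apply/funext => t; rewrite big_cons.
apply: leading_coefM; first by apply: Fc; rewrite mem_head.
by apply: IHr => j jr; apply: Fc; rewrite inE jr orbT.
Qed.

Lemma leading_coef_prod_ex (I : eqType) (r : seq I) (F : I -> C -> C) :
  (forall i, i \in r -> exists c, is_leading_coef (F i) c) ->
  exists c, is_leading_coef (fun t => \prod_(i <- r) F i t) c.
Proof.
move=> Fc; have {Fc} /choice[c Fc] : forall i, exists c, i \in r -> is_leading_coef (F i) c.
  move=> i; have [/Fc[c ?]|] := boolP (i \in r); first by exists c.
  by exists 0.
by exists (\prod_(i <- r) c i); exact: leading_coef_prod.
Qed.

Lemma leading_coefX c F n :
  is_leading_coef F c -> is_leading_coef (fun t => F t ^+ n) (c ^+ n).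
Proof.
move=> Fc; elim: n => [|n IHn]; first exact: leading_coef1.
have -> : (fun t => F t ^+ n.+1) = fun t => F t * F t ^+ n.
  by apply/funext => t; rewrite exprS.
by rewrite exprS; exact: leading_coefM.
Qed.

(** [xget] does not fall back on its default, since [c^-1] belongs to the set. *)
Lemma normalizing_constP c F : is_leading_coef F c ->
  normalizing_const F != 0 /\
  is_leading_coef (fun t => normalizing_const F * F t) 1.
Proof.
move=> Fc; have c0 : c != 0 by case: Fc.
have : [set e | is_leading_coef (fun t => e * F t) 1] (normalizing_const F).
  apply: xgetPex; exists c^-1 => /=; rewrite -[1](mulVf c0).
  by apply: leading_coefZ => //; rewrite invr_eq0.
(* If the constant were 0, the zero function would have leading coefficient 1, and after scaling by
   2 also leading coefficient 2. *)
move=> /= N1; split=> //; apply/eqP => n0.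
have N2 : (fun t => normalizing_const F * F t) = fun=> 0.
  by apply/funext => t; rewrite n0 mul0r.
rewrite N2 in N1; have two0 : (2 : C) != 0 by rewrite pnatr_eq0.
have := leading_coefZ _ _ _ two0 N1.
have -> : (fun=> 2 * 0 : C) = (fun _ : C => 0 : C) by apply/funext => t; rewrite mulr0.
move=> /(leading_coef_unique _ _ _ N1) /eqP.
by rewrite mulr1 -subr_eq0 -opprB oppr_eq0 -[2]/(1 + 1) addrK oner_eq0.
Qed.

End LeadingCoefficientAlgebra.

(** * Hecke products *)

Section Proportionality.
Variable R : realType.
Local Notation C := (cplx R).
Implicit Types (z t c : C) (F G H : C -> C).

(** This relation absorbs multiplier values, slash factors and normalizing constants. *)
Definition proportional F G :=
  exists2 c, c != 0 & mero_eq (@uhp R) F (fun t => c * G t).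

Lemma proportional_eq c F G : c != 0 -> (forall t, F t = c * G t) -> proportional F G.
Proof. by move=> c0 FG; exists c => // z _; apply: nearW. Qed.

Lemma proportional_refl F : proportional F F.
Proof. by apply: (proportional_eq 1) => [|t]; rewrite ?oner_neq0// mul1r. Qed.

Lemma proportional_sym F G : proportional F G -> proportional G F.
Proof.
move=> [c c0 FG]; exists c^-1; first by rewrite invr_eq0.
by move=> z /FG; apply: filterS => t ->; rewrite mulKf.
Qed.

Lemma proportional_trans F G H :
  proportional F G -> proportional G H -> proportional F H.
Proof.
move=> [c c0 FG] [d d0 GH]; exists (c * d); first exact: mulf_neq0.
move=> z zU; near=> t.
have -> : F t = c * G t by near: t; exact: FG.
by rewrite -mulrA; congr (c * _); near: t; exact: GH.
Unshelve. all: by end_near. Qed.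

Lemma proportionalM F F' G G' : proportional F G -> proportional F' G' ->
  proportional (fun t => F t * F' t) (fun t => G t * G' t).
Proof.
move=> [c c0 FG] [d d0 FG']; exists (c * d); first exact: mulf_neq0.
move=> z zU; near=> t.
have -> : F t = c * G t by near: t; exact: FG.
have -> : F' t = d * G' t by near: t; exact: FG'.
by rewrite mulrACA.
Unshelve. all: by end_near. Qed.

Lemma proportional_prod (I : eqType) (r : seq I) (F G : I -> C -> C) :
  (forall i, i \in r -> proportional (F i) (G i)) ->
  proportional (fun t => \prod_(i <- r) F i t) (fun t => \prod_(i <- r) G i t).
Proof.
elim: r => [|i r IHr] FG.
  by apply: (proportional_eq 1) => [|t]; rewrite ?oner_neq0// !big_nil mul1r.
have cons K : (fun t => \prod_(j <- i :: r) K j t) =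
    (fun t => K i t * \prod_(j <- r) K j t) :> (C -> C).
  by apply/funext => t; rewrite big_cons.
rewrite !cons; apply: proportionalM; first by apply: FG; rewrite mem_head.
by apply: IHr => j jr; apply: FG; rewrite inE jr orbT.
Qed.

Lemma proportional_prod_nat m n (F G : nat -> C -> C) :
  (forall i, (m <= i < n)%N -> proportional (F i) (G i)) ->
  proportional (fun t => \prod_(m <= i < n) F i t) (fun t => \prod_(m <= i < n) G i t).
Proof. by move=> FG; apply: proportional_prod => i; rewrite mem_index_iota; exact: FG. Qed.

Lemma proportionalX n F G :
  proportional F G -> proportional (fun t => F t ^+ n) (fun t => G t ^+ n).
Proof.
move=> [c c0 FG]; exists (c ^+ n); first by rewrite expf_neq0.
by move=> z /FG; apply: filterS => t ->; rewrite exprMn.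
Qed.

Lemma proportional_affine a b d F G : (0 < a)%N -> (0 < d)%N -> proportional F G ->
  proportional (fun t => F (affine a b d t)) (fun t => G (affine a b d t)).
Proof.
move=> a0 d0 [c c0 FG]; exists c => // z zU.
apply: (near_affine R a b d z (fun t => F t = c * G t) a0 d0); apply: FG.
by rewrite /uhp/= im_affine mulr_gt0// divr_gt0// ltr0n.
Qed.

Lemma affine_comp a b d a' b' d' (t : C) : (0 < d')%N ->
  affine a b d (affine a' b' d' t) = affine (a * a') (a * b' + b * d') (d * d') t.
Proof.
move=> d'0; have d'C : (d'%:R : C) != 0 by rewrite pnatr_eq0 -lt0n.
rewrite /affine !natrD !natrM invfM; move: (d%:R^-1) => i; field.
exact: d'C.
Qed.

Lemma affine_scale k a b d (t : C) : (0 < k)%N ->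
  affine (k * a) (k * b) (k * d) t = affine a b d t.
Proof.
move=> k0; have kC : (k%:R : C) != 0 by rewrite pnatr_eq0 -lt0n.
by rewrite /affine !natrM -mulrA -mulrDr -mulf_div divff// mul1r.
Qed.

End Proportionality.

Lemma big_nat_mul_addn (K : comPzSemiRingType) (u : nat -> K) n k :
  \prod_(0 <= i < n * k) u i =
  \prod_(0 <= i < n) \prod_(0 <= j < k) u (j + i * k)%N.
Proof.
rewrite big_nat_mul; apply: eq_bigr => i _.
by rewrite -[X in index_iota X _]add0n big_addn mulSn addnK.
Qed.

(** * Products over residues [b] modulo [d] *)

Section HeckeBlocks.
Variable R : realType.
Local Notation C := (cplx R).
Implicit Types (t : C) (F : C -> C).

Definition hecke_block F (a d : nat) t := \prod_(0 <= b < d) F (affine a b d t).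

(** [affine 1 1 1] is the translation [t + 1]. *)
Definition multiplicatively_periodic F :=
  proportional R (fun t => F (affine 1 1 1 t)) F.

(** Raising the shift from [c] to [c + 1] only replaces the factor with upper entry [c] by the one
    with [c + d], whose argument is the old one translated by 1. *)
Lemma hecke_block_shift F a d c : multiplicatively_periodic F ->
  (0 < a)%N -> (0 < d)%N ->
  proportional R (fun t => \prod_(0 <= b < d) F (affine a (b + c) d t))
    (hecke_block F a d).
Proof.
move=> F1 a0 d0; elim: c => [|c IHc].
  apply: (proportional_eq _ 1) => [|t]; first exact: oner_neq0.
  by rewrite mul1r; apply: eq_bigr => b _; rewrite addn0.
apply: proportional_trans IHc; case: d d0 => // d _.
have -> : (fun t => \prod_(0 <= b < d.+1) F (affine a (b + c.+1) d.+1 t)) =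
    (fun t => F (affine a (c + d.+1) d.+1 t) *
              \prod_(0 <= b < d) F (affine a (b + c.+1) d.+1 t)).
  by apply/funext => t; rewrite big_nat_recr//= mulrC addnS -addSn addnC.
have -> : (fun t => \prod_(0 <= b < d.+1) F (affine a (b + c) d.+1 t)) =
    (fun t => F (affine a c d.+1 t) *
              \prod_(0 <= b < d) F (affine a (b + c.+1) d.+1 t)).
  apply/funext => t; rewrite big_nat_recl//= add0n; congr (_ * _).
  by apply: eq_bigr => b _; rewrite addnS addSn.
apply: proportionalM; last exact: proportional_refl.
have -> : (fun t => F (affine a (c + d.+1) d.+1 t)) =
    (fun t => F (affine 1 1 1 (affine a c d.+1 t))).
  by apply/funext => t; rewrite affine_comp// !mul1n.
exact: (proportional_affine R a c d.+1 _ _ a0 (ltn0Sn d) F1).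
Qed.

(* The argument is the matrix product [[a d', b], [0, d]] [[a', b'], [0, d']],
   in which the scalar d' cancels. *)
Lemma hecke_cell_upper F a d a' d' : multiplicatively_periodic F ->
  (0 < a)%N -> (0 < d)%N -> (0 < a')%N -> (0 < d')%N ->
  proportional R
    (fun t => \prod_(0 <= b' < d') \prod_(0 <= b < d)
       F (affine (a * d') b d (affine a' b' d' t)))
    (fun t => hecke_block F (a * a') d t ^+ d').
Proof.
move=> F1 a0 d0 a'0 d'0.
have -> : (fun t => hecke_block F (a * a') d t ^+ d') =
    (fun t => \prod_(0 <= b' < d') hecke_block F (a * a') d t).
  by apply/funext => t; rewrite prodr_const_nat subn0.
apply: proportional_prod_nat => b' _.
have -> : (fun t => \prod_(0 <= b < d) F (affine (a * d') b d (affine a' b' d' t))) =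
    (fun t => \prod_(0 <= b < d) F (affine (a * a') (b + a * b') d t)).
  apply/funext => t; apply: eq_bigr => b _; rewrite affine_comp//.
  by rewrite -[in RHS](affine_scale _ d' _ _ _ _ d'0); congr (F (affine _ _ _ t)); lia.
by apply: hecke_block_shift; rewrite // muln_gt0 a0.
Qed.

(* Here the scalar a cancels from [[a, b], [0, d]] [[a', b'], [0, a m]]; writing
   b' = f + c m with f < m and c < a, the numbers b m + f run over [0, d m) and
   c only shifts them. *)
Lemma hecke_cell_lower F a d a' m : multiplicatively_periodic F ->
  (0 < a)%N -> (0 < d)%N -> (0 < a')%N -> (0 < m)%N ->
  proportional R
    (fun t => \prod_(0 <= b' < a * m) \prod_(0 <= b < d)
       F (affine a b d (affine a' b' (a * m) t)))
    (fun t => hecke_block F a' (d * m) t ^+ a).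
Proof.
move=> F1 a0 d0 a'0 m0.
have -> : (fun t => hecke_block F a' (d * m) t ^+ a) =
    (fun t => \prod_(0 <= c < a) hecke_block F a' (d * m) t).
  by apply/funext => t; rewrite prodr_const_nat subn0.
have -> : (fun t => \prod_(0 <= b' < a * m) \prod_(0 <= b < d)
       F (affine a b d (affine a' b' (a * m) t))) =
    (fun t => \prod_(0 <= c < a) \prod_(0 <= b < d * m)
       F (affine a' (b + c * m) (d * m) t)).
  apply/funext => t; rewrite big_nat_mul_addn; apply: eq_bigr => c _.
  rewrite [RHS]big_nat_mul_addn exchange_big/=; apply: eq_bigr => b _.
  apply: eq_bigr => f _; rewrite affine_comp ?muln_gt0 ?a0//.
  by rewrite -[in RHS](affine_scale _ a _ _ _ _ a0); congr (F (affine _ _ _ t)); lia.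
apply: proportional_prod_nat => c _.
by apply: hecke_block_shift; rewrite // muln_gt0 d0.
Qed.

End HeckeBlocks.

(* The bijection behind the Hecke relation.  A pair (e, e') stands for the
   product of the matrices [[p ^ (r - e), *], [0, p ^ e]] and
   [[p ^ (s - e'), *], [0, p ^ e']]; p ^ j is its scalar factor, and p ^ y the
   lower right entry that is left. *)
Lemma prod_reindex_min (K : comPzSemiRingType) (r s : nat) (phi : nat -> nat -> K) :
  \prod_(0 <= e' < s.+1) \prod_(0 <= e < r.+1)
    phi (minn (r - e) e') (e + e' - minn (r - e) e')%N =
  \prod_(0 <= j < (minn r s).+1) \prod_(0 <= y < (r + s - 2 * j).+1) phi j y.
Proof.
have bound (e' e : nat) : (0 <= e' < 0 + s.+1)%N -> (0 <= e < 0 + r.+1)%N ->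
  (0 <= e + e' - minn (r - e) e' < 0 + (r + s - 2 * minn (r - e) e').+1)%N by lia.
pose g e' e := (minn (r - e) e', e + e' - minn (r - e) e')%N.
transitivity (\prod_(q <- [seq g e' e | e' <- iota 0 s.+1, e <- iota 0 r.+1]) phi q.1 q.2).
  by rewrite big_allpairs_dep /index_iota !subn0.
transitivity (\prod_(q <- [seq (j, y) | j <- iota 0 (minn r s).+1,
    y <- iota 0 (r + s - 2 * j).+1]) phi q.1 q.2); last first.
  rewrite big_allpairs_dep /index_iota subn0.
  by apply: eq_bigr => j _; rewrite subn0.
apply: perm_big; apply: uniq_perm.
- apply: allpairs_uniq_dep => [|e' _|]; rewrite ?iota_uniq//.
  move=> q1 q2 /allpairsPdep[e1 [e [+ + ->]]] /allpairsPdep[f1 [f [+ + ->]]].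
  rewrite !mem_iota /g /= => e1s er f1s fr [E1 E2].
  by have [-> ->] : e1 = f1 /\ e = f by lia.
- apply: allpairs_uniq_dep => [|e' _|]; rewrite ?iota_uniq//.
  by move=> [? ?] [? ?] /= _ _ [-> ->].
move=> [j y]; apply/allpairsPdep/allpairsPdep.
  move=> [e1 [e []]]; rewrite !mem_iota /g => ? ? [-> ->].
  exists (minn (r - e) e1), (e + e1 - minn (r - e) e1)%N.
  by split; rewrite ?mem_iota; [lia | exact: bound | by []].
move=> [j' [y' []]]; rewrite !mem_iota => ? ? [-> ->].
(* The inverse map: if [y' + j' <= r] the minimum is [e'], so [e' = j'] and [e = y']. Otherwise it
   is [r - e], so [e = r - j'] and [e' = y' + 2 j' - r]. *)
have [yj|yj] := leqP (y' + j') r.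
  by exists j', y'; rewrite !mem_iota /g; split; [lia | lia | congr pair; lia].
exists (y' + 2 * j' - r)%N, (r - j')%N; rewrite !mem_iota /g.
by split; [lia | lia | congr pair; lia].
Qed.

(** * Hecke operators at powers of [p], up to constants *)

Section HeckeProducts.
Variables (R : realType) (p : nat) (p_prime : prime p).
Local Notation C := (cplx R).
Implicit Types (t c : C) (F G : C -> C).

Let pX n : (0 < p ^ n)%N. Proof. by rewrite expn_gt0 prime_gt0. Qed.

Lemma prod_divisors_pfactor (K : comPzSemiRingType) (u : nat -> K) n :
  \prod_(d <- divisors (p ^ n)) u d = \prod_(0 <= e < n.+1) u (p ^ e)%N.
Proof.
rewrite /index_iota subn0 -(big_map (fun e => (p ^ e)%N) xpredT u).
apply: perm_big; apply: uniq_perm; first exact: divisors_uniq.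
  by rewrite map_inj_uniq ?iota_uniq//; apply: expnI; exact: prime_gt1.
move=> d; rewrite -dvdn_divisors//; apply/dvdn_pfactor/mapP => //.
  by move=> [e en ->]; exists e; rewrite ?mem_iota.
by move=> [e]; rewrite mem_iota => en ->; exists e; lia.
Qed.

(* f|T(p ^ n) without its constant factors; d = p ^ e and a = p ^ (n - e). *)
Definition hecke_raw n F t :=
  \prod_(0 <= e < n.+1) hecke_block R F (p ^ (n - e)) (p ^ e) t.

Lemma hecke_raw_proportional n F G : proportional R F G ->
  proportional R (hecke_raw n F) (hecke_raw n G).
Proof.
move=> FG; apply: proportional_prod_nat => e _.
by apply: proportional_prod_nat => b _; exact: proportional_affine.
Qed.

Lemma hecke_raw_leading_coef n F c : is_leading_coef F c ->
  exists d, is_leading_coef (hecke_raw n F) d.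
Proof.
move=> Fc; apply: leading_coef_prod_ex => e _; apply: leading_coef_prod_ex => b _.
exact: leading_coef_affine Fc.
Qed.

(** Each pair [(e, e')] of exponents contributes a power of a single [hecke_block], the power being
    the scalar factor [p ^ j] with [j = minn (r - e) e']. [prod_reindex_min] then groups the pairs
    by [j]. *)
Lemma hecke_raw_comp r s F : multiplicatively_periodic R F ->
  proportional R (hecke_raw s (hecke_raw r F))
    (fun t => \prod_(0 <= j < (minn r s).+1) hecke_raw (r + s - 2 * j) F t ^+ (p ^ j)).
Proof.
move=> F1.
have -> : (fun t => \prod_(0 <= j < (minn r s).+1) hecke_raw (r + s - 2 * j) F t ^+ (p ^ j)) =
    (fun t => \prod_(0 <= e' < s.+1) \prod_(0 <= e < r.+1)
       (let j := minn (r - e) e' in let y := (e + e' - j)%N in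
        hecke_block R F (p ^ (r + s - 2 * j - y)) (p ^ y) t ^+ (p ^ j))).
  apply/funext => t.
  rewrite (prod_reindex_min _ _ _ (fun j y =>
    hecke_block R F (p ^ (r + s - 2 * j - y)) (p ^ y) t ^+ (p ^ j))).
  by apply: eq_bigr => j _; rewrite prodrXl.
have -> : hecke_raw s (hecke_raw r F) =
    (fun t => \prod_(0 <= e' < s.+1) \prod_(0 <= e < r.+1)
      \prod_(0 <= b' < p ^ e') \prod_(0 <= b < p ^ e)
        F (affine (p ^ (r - e)) b (p ^ e) (affine (p ^ (s - e')) b' (p ^ e') t))).
  by apply/funext => t; apply: eq_bigr => e' _; rewrite [LHS]exchange_big.
apply: proportional_prod_nat => e' /andP[_ e's].
apply: proportional_prod_nat => e /andP[_ er] /=.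
(* Either [p ^ e'] divides [p ^ (r - e)] and cancels as the scalar, or the converse. *)
have [ee'|/ltnW ee'] := leqP e' (r - e).
  have -> : (p ^ (r - e) = p ^ (r - e - e') * p ^ e')%N by rewrite -expnD subnK.
  have -> : (e + e' - e' = e)%N by rewrite addnK.
  have -> : (p ^ (r + s - 2 * e' - e) = p ^ (r - e - e') * p ^ (s - e'))%N.
    by rewrite -expnD; congr (p ^ _)%N; lia.
  exact: hecke_cell_upper.
have E : (p ^ e' = p ^ (r - e) * p ^ (e' - (r - e)))%N by rewrite -expnD subnKC.
have -> : (p ^ (e + e' - (r - e)) = p ^ e * p ^ (e' - (r - e)))%N.
  by rewrite -expnD; congr (p ^ _)%N; lia.
have -> : (r + s - 2 * (r - e) - (e + e' - (r - e)) = s - e')%N by lia.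
by rewrite E; exact: hecke_cell_lower.
Qed.

(** With lower row (0, d) the automorphy factor is the constant [d], and the determinant [a d] is
    positive. *)
Lemma slash_upper_triangular (k : int) (a b d : nat) : (0 < a)%N -> (0 < d)%N ->
  exists2 c : C, c != 0 &
    forall (f : C -> C) t, slash k (mx22 a b 0 d) f t = c * f (affine a b d t).
Proof.
move=> a0 d0.
exists (creal ((\det (mx22 a b 0 d))%:~R `^ (k%:~R / 2)) * (d%:R : C) ^ (- k)).
  rewrite mulf_neq0 ?creal_eq0 ?expfz_neq0 ?pnatr_eq0 -?lt0n// gt_eqF// powR_gt0//.
  rewrite ltr0z (expand_det_row _ ord0) big_ord_recl big_ord1 /cofactor !det_mx11 !mxE/=.
  rewrite expr0 mul1r; lia.
move=> f t; rewrite /slash /moebius /autj !mxE/= mul0r add0r.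
by rewrite -!pmulrn.
Qed.

Lemma hecke_prodE (k : int) n : exists2 c : C, c != 0 &
  forall (f : C -> C) t, hecke_prod k (p ^ n) f t = c * hecke_raw n f t.
Proof.
have /choice[c cP] : forall q : nat * nat, exists c : C, c != 0 /\
    forall (f : C -> C) t, slash k (mx22 (p ^ (n - q.1))%N q.2 0 (p ^ q.1)%N) f t =
      c * f (affine (p ^ (n - q.1)) q.2 (p ^ q.1) t).
  move=> [e b]; have [c c0 cE] := slash_upper_triangular k _ b _ (pX (n - e)) (pX e).
  by exists c.
exists (\prod_(0 <= e < n.+1) \prod_(0 <= b < p ^ e) c (e, b)).
  rewrite prodf_seq_neq0; apply/allP => e _ /=.
  by rewrite prodf_seq_neq0; apply/allP => b _ /=; case: (cP (e, b)).
move=> f t; rewrite /hecke_prod prod_divisors_pfactor -big_split/=.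
apply: eq_big_nat => e /andP[_ en]; rewrite -big_split/=.
apply: eq_bigr => b _; rewrite -expnB ?prime_gt0//.
by case: (cP (e, b)) => _ /= ->.
Qed.

(** The second conclusion has the form of the hypothesis, so the lemma applies again to
    [heckeT (p ^ r) f]. *)
Lemma heckeT_proportional n (f : weighted R) : is_leading_coef f 1 ->
  proportional R (heckeT (p ^ n) f) (hecke_raw n f) /\
  is_leading_coef (heckeT (p ^ n) f) 1.
Proof.
(* The first branch is [n = 0], where the raw product has one factor, given by the identity
   matrix. *)
move=> f1; rewrite /heckeT; case: ifPn => [/eqP pn1|pn1] /=.
  split=> //; have n0 : n = 0%N.
    by apply/eqP; rewrite -(eqn_exp2l _ _ (prime_gt1 p_prime)) pn1.
  apply: (proportional_eq _ 1) => [|t]; first exact: oner_neq0.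
  rewrite n0 mul1r /hecke_raw /hecke_block !big_nat1 expn0.
  by rewrite /affine addr0 divr1 mul1r.
set k := hecke_const _ _ _ _; set g := fun t => creal k * _.
have [c c0 cE] := hecke_prodE (weight f) n.
have k0 : creal k != 0 by rewrite creal_eq0 gt_eqF// powR_gt0// ltr0n pdiv_gt0.
have gE : g = fun t => creal k * c * hecke_raw n f t.
  by apply/funext => t; rewrite -mulrA -cE.
have [d hd] := hecke_raw_leading_coef n f 1 f1.
have gd : is_leading_coef g (creal k * c * d).
  by rewrite gE; apply: leading_coefZ => //; rewrite mulf_neq0.
have [e0 e1] := normalizing_constP _ _ _ gd; split=> //.
apply: (proportional_eq _ (normalizing_const g * (creal k * c))) => [|t].
  by rewrite !mulf_neq0.
by rewrite cE !mulrA.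
Qed.

End HeckeProducts.

(** * The Hecke relation for modular forms *)

Lemma modular_form_leading_coef (R : realType) N (f : weighted R) :
  modular_form N f -> is_leading_coef f 1.
Proof.
move=> [_ _ _ [h [a [a0 fa]]]]; split; first exact: oner_neq0.
by exists 1%N, h, (fun n => (a n)%:~R); split; rewrite // a0.
Qed.

(** The matrix [[1, 1], [0, 1]] lies in [Gamma0 N] and has automorphy factor 1; its multiplier value
    is nonzero, having norm 1. *)
Lemma modular_form_periodic (R : realType) N (f : weighted R) :
  modular_form N f -> multiplicatively_periodic R f.
Proof.
move=> [_ [chi chiP] _ _].
have [|chi1 fT] := chiP (mx22 1 1 0 1).
  split; last by rewrite mxE /= dvdz0.
  by rewrite (expand_det_row _ ord0) big_ord_recl big_ord1 /cofactor !det_mx11 !mxE.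
exists (chi (mx22 1 1 0 1)); first by rewrite -normr_eq0 chi1 oner_neq0.
move=> z /fT; apply: filterS => t.
by rewrite /moebius /autj !mxE /= mul0r add0r exp1rz mulr1.
Qed.

Theorem theorem3p4 (R : realType) (N p r s : nat) (f : weighted R)
  (N_gt0 : (0 < N)%N) (p_prime : prime p) (pN : ~~ (p %| N)%N)
  (r_gt0 : (0 < r)%N) (s_gt0 : (0 < s)%N) (fN : modular_form N f) :
  mero_eq (@uhp R)
    (heckeT (p ^ s) (heckeT (p ^ r) f))
    (fun t => \prod_(d <- divisors (gcdn (p ^ r) (p ^ s)))
                heckeT (p ^ (r + s) %/ d ^ 2) f t ^+ d).
Proof.
have f1 := modular_form_leading_coef _ _ _ fN.
have fT := modular_form_periodic _ _ _ fN.
have gcdE : gcdn (p ^ r) (p ^ s) = (p ^ minn r s)%N.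
  have [rs|/ltnW rs] := leqP r s; first exact/gcdn_idPl/dvdn_exp2l.
  exact/gcdn_idPr/dvdn_exp2l.
have -> : (fun t => \prod_(d <- divisors (gcdn (p ^ r) (p ^ s)))
                heckeT (p ^ (r + s) %/ d ^ 2) f t ^+ d) =
    (fun t => \prod_(0 <= j < (minn r s).+1) heckeT (p ^ (r + s - 2 * j)) f t ^+ (p ^ j)).
  apply/funext => t; rewrite gcdE prod_divisors_pfactor//.
  apply: eq_big_nat => j /andP[_ jrs].
  have jrs2 : (j * 2 <= r + s)%N by lia.
  have -> : (p ^ (r + s) %/ (p ^ j) ^ 2 = p ^ (r + s - 2 * j))%N.
    by rewrite -expnM -expnB ?prime_gt0// mulnC.
  by [].
have [r_raw r1] := heckeT_proportional _ _ p_prime r _ f1.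
have [s_raw s1] := heckeT_proportional _ _ p_prime s _ r1.
set F := heckeT (p ^ s) _; set G := fun t => _.
(* The outer operator is replaced by its raw product, then the inner one; the raw relation applies,
   and each raw factor is turned back into a Hecke operator. *)
have [c c0 FG] : proportional R F G.
  apply: proportional_trans s_raw _.
  apply: proportional_trans (hecke_raw_proportional _ _ p_prime s _ _ r_raw) _.
  apply: proportional_trans (hecke_raw_comp _ _ p_prime r s _ fT) _.
  apply: proportional_prod_nat => j _; apply: proportionalX.
  exact/proportional_sym/(heckeT_proportional _ _ p_prime _ _ f1).1.
have G1 : is_leading_coef G 1.
  rewrite [1](_ : _ = \prod_(0 <= j < (minn r s).+1) 1); last by rewrite big1.
  apply: leading_coef_prod => j _; rewrite -[1](expr1n _ (p ^ j)%N).
  apply: leading_coefX; exact: (heckeT_proportional _ _ p_prime _ _ f1).2.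
(* [F] agrees with [c * G] and has leading coefficient 1, while that of [c * G] is [c]. *)
have c1 : c = 1.
  apply: leading_coef_unique (leading_coef_mero_eq _ _ _ _ FG s1).
  by rewrite -[X in is_leading_coef _ X]mulr1; exact: leading_coefZ.
by move=> z /FG; apply: filterS => t ->; rewrite c1 mul1r.
Qed.
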